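(* Let $n\ge 1$, let $B=(b_{ij})$ be a real $n\times n$ matrix with $b_{ij}\ge 0$ for all $i,j$ and $b_{ii}=0$ for all $i$, let $c\in\mathbb{R}^n$ and $X\subseteq\{0,1\}^n$. Let $\overline{X}$ be a relaxation of $X$ with $X\subseteq\overline{X}\subseteq[0,1]^n$, and for $i=1,\dots,n$ let $u_i=\max\{\sum_{j\neq i}b_{ij}x_j : x\in\overline{X}\}$. Consider (P): minimize $x^TBx+c^Tx$ subject to $x\in X$; (PL$_1$): minimize $\sum_{i=1}^n (y_i+c_ix_i)$ over $(x,y)\in X\times\mathbb{R}^n$ subject to $y_i\ge \sum_{j\neq i}b_{ij}x_j+u_ix_i-u_i$ and $y_i\ge 0$ for $i=1,\dots,n$. Then (P) and (PL$_1$) are equivalent in the sense that for each optimal solution to one problem, there exists an optimal solution to the other problem having the same optimal objective value.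
   Context: (P) is the generalized quadratic 0-1 program. The relaxation $\overline{X}$ is assumed chosen so that the maxima defining $u_i$ are attained. *)

(* Defs.v *)
From HB Require Import structures.
From mathcomp Require Import all_boot all_order all_algebra.
From mathcomp Require Import all_classical reals.

Set Implicit Arguments.
Unset Strict Implicit.
Unset Printing Implicit Defensive.

Import Order.TTheory GRing.Theory Num.Theory.

Local Open Scope classical_set_scope.
Local Open Scope ring_scope.

Definition binary_cube (R : realType) (n : nat) : set 'cV[R]_n :=
  [set x | forall i, x i 0 = 0 \/ x i 0 = 1].

Definition unit_cube (R : realType) (n : nat) : set 'cV[R]_n :=
  [set x | forall i, 0 <= x i 0 <= 1].

Definition offdiag_sum (R : realType) (n : nat) (B : 'M[R]_n) (i : 'I_n)
    (x : 'cV[R]_n) : R :=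
  \sum_(j < n | j != i) B i j * x j 0.

(* Unlike [sup A], this asserts that the maximum is attained. *)
Definition is_max (R : realType) (A : set R) (m : R) : Prop :=
  A m /\ ubound A m.

Definition is_minimizer (R : realType) (T : Type) (F : set T) (f : T -> R)
    (z : T) : Prop :=
  F z /\ forall w, F w -> f z <= f w.

Definition objP (R : realType) (n : nat) (B : 'M[R]_n) (c : 'cV[R]_n)
    (x : 'cV[R]_n) : R :=
  (x^T *m B *m x) 0 0 + (c^T *m x) 0 0.

(* In (PL_1) a point is the pair z = (x, y). *)
Definition feasPL1 (R : realType) (n : nat) (B : 'M[R]_n) (X : set 'cV[R]_n)
    (u : 'I_n -> R) : set ('cV[R]_n * 'cV[R]_n) :=
  [set z : 'cV[R]_n * 'cV[R]_n | X z.1 /\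
     forall i, offdiag_sum B i z.1 + u i * z.1 i 0 - u i <= z.2 i 0
               /\ 0 <= z.2 i 0].

Definition objPL1 (R : realType) (n : nat) (c : 'cV[R]_n)
    (z : 'cV[R]_n * 'cV[R]_n) : R :=
  \sum_(i < n) (z.2 i 0 + c i 0 * z.1 i 0).

(* Main.v *)
(* At a binary x the quadratic form is the sum of the products
   x_i * offdiag_sum B i x, and these are the smallest y_i allowed by the
   constraints of (PL_1): for x_i = 1 the first constraint reads
   y_i >= offdiag_sum B i x, and for x_i = 0 it is implied by y_i >= 0, since
   u_i bounds offdiag_sum B i on X. *)
Require Import Defs.
From HB Require Import structures.
From mathcomp Require Import all_boot all_order all_algebra.
From mathcomp Require Import all_classical reals.

Set Implicit Arguments.
Unset Strict Implicit.
Unset Printing Implicit Defensive.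

Import Order.TTheory GRing.Theory Num.Theory.

Local Open Scope classical_set_scope.
Local Open Scope ring_scope.

Definition liftPL1 (R : realType) (n : nat) (B : 'M[R]_n) (x : 'cV[R]_n) :
    'cV[R]_n * 'cV[R]_n :=
  (x, \col_i (x i 0 * offdiag_sum B i x)).

(** Expand [x^T (B x)] row by row: in row [i] the zero diagonal removes the term [j = i]. *)
Lemma objP_offdiag (R : realType) (n : nat) (B : 'M[R]_n) (c x : 'cV[R]_n) :
  (forall i, B i i = 0) ->
  objP B c x = \sum_(i < n) (x i 0 * offdiag_sum B i x + c i 0 * x i 0).
Proof.
move=> B0; rewrite /objP -mulmxA !mxE -big_split /=.
by apply: eq_bigr => i _; rewrite !mxE (bigD1 i) //= B0 mul0r add0r.
Qed.

Lemma objPL1_liftPL1 (R : realType) (n : nat) (B : 'M[R]_n) (c x : 'cV[R]_n) :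
  (forall i, B i i = 0) -> objPL1 c (liftPL1 B x) = objP B c x.
Proof.
by move=> B0; rewrite objP_offdiag //; apply: eq_bigr => i _; rewrite mxE.
Qed.

Lemma liftPL1_feasible (R : realType) (n : nat) (B : 'M[R]_n)
    (X : set 'cV[R]_n) (u : 'I_n -> R) (x : 'cV[R]_n) :
  (forall i j, 0 <= B i j) -> binary_cube x -> X x ->
  (forall i, offdiag_sum B i x <= u i) -> feasPL1 B X u (liftPL1 B x).
Proof.
move=> B_ge0 xbin Xx xu; split=> // i; rewrite !mxE /=.
have x_ge0 j : 0 <= x j 0 by case: (xbin j) => ->.
split; last by rewrite mulr_ge0 // sumr_ge0 // => j _; rewrite mulr_ge0.
(* For [x_i = 0] the constraint is exactly the bound by [u i]; for [x_i = 1] the two [u i] cancel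
   and it is tight. *)
case: (xbin i) => ->; first by rewrite mulr0 addr0 mul0r subr_le0.
by rewrite mulr1 mul1r addrK.
Qed.

(** The comparison is termwise: [0 <= y_i] settles [x_i = 0], and the constraint with [u i] settles
    [x_i = 1]. *)
Lemma objP_le_objPL1 (R : realType) (n : nat) (B : 'M[R]_n) (c : 'cV[R]_n)
    (X : set 'cV[R]_n) (u : 'I_n -> R) (z : 'cV[R]_n * 'cV[R]_n) :
  (forall i, B i i = 0) -> binary_cube z.1 -> feasPL1 B X u z ->
  objP B c z.1 <= objPL1 c z.
Proof.
move=> B0 zbin [_ zy]; rewrite objP_offdiag //; apply: ler_sum => i _.
rewrite lerD2r; have [] := zy i.
by case: (zbin i) => ->; rewrite ?mul0r // mulr1 mul1r addrK.
Qed.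

Theorem theorem1 (R : realType) (n : nat) (hn : (1 <= n)%N)
    (B : 'M[R]_n) (hB : forall i j, 0 <= B i j) (hB0 : forall i, B i i = 0)
    (c : 'cV[R]_n)
    (X : set 'cV[R]_n) (hX : X `<=` @binary_cube R n)
    (Xbar : set 'cV[R]_n) (hXXbar : X `<=` Xbar)
    (hXbar : Xbar `<=` @unit_cube R n)
    (u : 'I_n -> R)
    (hu : forall i, is_max [set offdiag_sum B i x | x in Xbar] (u i)) :
  (forall x, is_minimizer X (objP B c) x ->
     exists z, is_minimizer (feasPL1 B X u) (objPL1 c) z
               /\ objPL1 c z = objP B c x) /\
  (forall z, is_minimizer (feasPL1 B X u) (objPL1 c) z ->
     exists x, is_minimizer X (objP B c) x
               /\ objP B c x = objPL1 c z).
Proof.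
have hu_ub i x : X x -> offdiag_sum B i x <= u i.
  by move=> Xx; apply: (hu i).2; exists x => //; exact: hXXbar.
have hlift x : X x -> feasPL1 B X u (liftPL1 B x).
  by move=> Xx; apply: liftPL1_feasible => // [|i]; [exact: hX|exact: hu_ub].
have hlow z : feasPL1 B X u z -> objP B c z.1 <= objPL1 c z.
  by move=> Fz; exact: objP_le_objPL1 hB0 (hX _ Fz.1) Fz.
split=> [x [Xx xmin]|z [Fz zmin]].
  exists (liftPL1 B x); rewrite objPL1_liftPL1 //; split=> //.
  split=> [|w Fw]; first exact: hlift.
  (* The chain is [objP x <= objP w.1 <= objPL1 w]. *)
  rewrite objPL1_liftPL1 //; apply: le_trans (hlow _ Fw); apply: xmin; exact: Fw.1.
have Xz : X z.1 := Fz.1.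
(* Optimality of [z] against the lift of its own first component gives the inequality opposite to
   [hlow]. *)
have ez : objP B c z.1 = objPL1 c z.
  by apply/le_anti; rewrite hlow //= -objPL1_liftPL1 //; apply: zmin; exact: hlift.
exists z.1; split=> //; split=> // w Xw.
(* Any competitor [w] in [X] is tested against [z] through its lift, which has the value
   [objP B c w]. *)
by rewrite ez -objPL1_liftPL1 //; apply: zmin; exact: hlift.
Qed.
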